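(* Let $X \subseteq \mathbb{P}^n$ be a quadric of rank at least three over $\mathbb{K}$. Then the complement $Y = \mathbb{P}^n \setminus X$ admits a transversal covering by principal cylinders.
   Context: $\mathbb{K}$ is an algebraically closed field of characteristic zero; a variety is an integral separated scheme of finite type over $\mathbb{K}$. The rank of a quadric is the rank of a quadratic form defining it. The complement $Y$ of a hypersurface in $\mathbb{P}^n$ is an affine variety. For a positive integer $k$, a $k$-cylinder in a variety $Y$ is an open subset $U \subseteq Y$ together with an isomorphism $U \cong \mathbb{A}^k \times Z$ for some affine variety $Z$; a cylinder is a $k$-cylinder for some $k \ge 1$. A cylinder $U$ in an affine variety $Y$ is principal if $U = \{y \in Y \mid h(y) \neq 0\}$ for some regular function $h$ on $Y$. Given a cylinder $U \cong \mathbb{A}^k \times Z$ in $Y$ with projection $\pi \colon U \to Z$, a subset $S \subseteq Y$ is invariant with respect to $U$ if $S \cap U = \pi^{-1}(\pi(S \cap U))$; it is invariant with respect to a collection of cylinders if it is invariant with respect to each of them. A collection $\{U_i\}_{i \in I}$ of cylinders is transversal if no nonempty proper subset of $\bigcup_{i\in I} U_i$ is invariant with respect to the collection. A transversal covering of $Y$ is a transversal collection of cylinders in $Y$ whose union is $Y$. *)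

(* Defs.v *)
From mathcomp Require Import all_boot all_order all_algebra.
From mathcomp Require Import boolp classical_sets.
From mathcomp Require Import mpoly.

Set Implicit Arguments.
Unset Strict Implicit.
Unset Printing Implicit Defensive.

Import GRing.Theory.
Local Open Scope ring_scope.
Local Open Scope classical_set_scope.

(* Varieties over an algebraically closed field are treated classically,
   through their K-points: a variety is a subset of an ambient space (affine or
   projective space), with the induced Zariski topology and the K-valued
   functions that are locally quotients of polynomials. *)

(* [fraction a b] says that a / b is a globally defined formal quotient of
   polynomials; see [affine_fraction] and [proj_fraction] below. *)
Record ambient (K : fieldType) := Ambient {
  ambient_pt :> Type;
  zclosed : set (set ambient_pt);
  fraction : (ambient_pt -> K) -> (ambient_pt -> K) -> Prop }.

Section AffineSpace.
Variables (K : fieldType) (m : nat).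

Definition affine_zeros (I : set {mpoly K[m]}) : set 'rV[K]_m :=
  [set x | forall p, I p -> p.@[x ord0] = 0].

Definition affine_fraction (a b : 'rV[K]_m -> K) : Prop :=
  exists p q : {mpoly K[m]},
    a = (fun x => p.@[x ord0]) /\ b = (fun x => q.@[x ord0]).

Definition affine_space : ambient K :=
  Ambient (range affine_zeros) affine_fraction.

End AffineSpace.

Section ProjectiveSpace.
Variables (K : fieldType) (n : nat).

Record proj_point := ProjPoint {
  line : {vspace 'rV[K]_n.+1};
  dim_line : \dim line = 1%N }.

(* Homogeneous coordinates: some nonzero vector of the line.  They are only used
   where the choice does not matter, namely in vanishing conditions on
   homogeneous polynomials and in quotients of homogeneous polynomials of equal
   degree. *)
Definition hcoord (x : proj_point) : 'I_n.+1 -> K := vpick (line x) ord0.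

Definition proj_zeros (I : set {mpoly K[n.+1]}) : set proj_point :=
  [set x | forall p, I p -> p.@[hcoord x] = 0].

Definition proj_closed : set (set proj_point) :=
  [set C | exists I : set {mpoly K[n.+1]},
     (forall p, I p -> exists d : nat, p \is d.-homog) /\ C = proj_zeros I].

Definition proj_fraction (a b : proj_point -> K) : Prop :=
  exists (d : nat) (p q : {mpoly K[n.+1]}),
    [/\ p \is d.-homog, q \is d.-homog,
        a = (fun x => p.@[hcoord x]) & b = (fun x => q.@[hcoord x])].

Definition proj_space : ambient K := Ambient proj_closed proj_fraction.

End ProjectiveSpace.

Section Morphisms.
Variable K : fieldType.

Definition zopen (X : ambient K) (O : set X) : Prop := zclosed (~` O).

Definition open_in (X : ambient K) (V W : set X) : Prop :=
  exists O : set X, zopen O /\ W = V `&` O.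

Definition irreducible_set (X : ambient K) (V : set X) : Prop :=
  V !=set0 /\
  forall C D : set X, zclosed C -> zclosed D ->
    V `<=` C `|` D -> V `<=` C \/ V `<=` D.

(* Values of f outside W are irrelevant. *)
Definition regular_on (X : ambient K) (W : set X) (f : X -> K) : Prop :=
  forall x, W x -> exists (O : set X) (a b : X -> K),
    [/\ zopen O, O x, fraction a b
      & forall y, W y -> O y -> b y != 0 /\ f y = a y / b y].

Definition morphism_on (X X' : ambient K) (V : set X) (V' : set X')
    (phi : X -> X') : Prop :=
  [/\ forall x, V x -> V' (phi x),
      forall W, open_in V' W -> open_in V (V `&` phi @^-1` W)
    & forall W f, open_in V' W -> regular_on W f ->
        regular_on (V `&` phi @^-1` W) (f \o phi)].

Definition isomorphism_on (X X' : ambient K) (V : set X) (V' : set X')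
    (phi : X -> X') : Prop :=
  morphism_on V V' phi /\
  exists psi : X' -> X,
    [/\ morphism_on V' V psi,
        forall x, V x -> psi (phi x) = x
      & forall y, V' y -> phi (psi y) = y].

(* Affine varieties, up to isomorphism. *)
Definition affine_variety (m : nat) (Z : set (affine_space K m)) : Prop :=
  zclosed Z /\ irreducible_set Z.

Definition affine_space_times (k m : nat) (Z : set (affine_space K m)) :
    set (affine_space K (k + m)) :=
  [set v | Z (rsubmx v)].

End Morphisms.

Arguments affine_space_times [K] k [m] Z.

Section Cylinders.
Variables (K : fieldType) (X : ambient K) (Y : set X).

Record cylinder := Cylinder {
  cyl_set : set X;
  cyl_open : open_in Y cyl_set;
  cyl_dim : nat;
  cyl_dim_gt0 : (0 < cyl_dim)%N;
  cyl_base_dim : nat;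
  cyl_base : set (affine_space K cyl_base_dim);
  cyl_base_variety : affine_variety cyl_base;
  cyl_map : X -> affine_space K (cyl_dim + cyl_base_dim);
  cyl_map_iso :
    isomorphism_on cyl_set (affine_space_times cyl_dim cyl_base) cyl_map }.

Definition cyl_proj (U : cylinder) (x : X) :
    affine_space K (cyl_base_dim U) :=
  rsubmx (cyl_map U x).

Definition principal (U : cylinder) : Prop :=
  exists h : X -> K, regular_on Y h /\ cyl_set U = [set y | Y y /\ h y != 0].

Definition invariant (U : cylinder) (S : set X) : Prop :=
  S `&` cyl_set U =
  cyl_set U `&` cyl_proj U @^-1` (cyl_proj U @` (S `&` cyl_set U)).

Definition transversal (I : Type) (U : I -> cylinder) : Prop :=
  ~ exists S : set X,
      [/\ S !=set0, S `<` \bigcup_i cyl_set (U i)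
        & forall i, invariant (U i) S].

Definition transversal_covering (I : Type) (U : I -> cylinder) : Prop :=
  transversal U /\ \bigcup_i cyl_set (U i) = Y.

End Cylinders.

Section Quadrics.
Variables (K : fieldType) (n : nat).

(* The rank of a quadratic form in characteristic different from 2 is the rank
   of the matrix of its polar bilinear form (q(x + y) - q(x) - q(y)) / 2. *)
Definition qform_mx (q : {mpoly K[n.+1]}) : 'M[K]_n.+1 :=
  \matrix_(i, j)
    (2^-1 * (q.@[(delta_mx ord0 i + delta_mx ord0 j : 'rV[K]_n.+1) ord0]
             - q.@[(delta_mx ord0 i : 'rV[K]_n.+1) ord0]
             - q.@[(delta_mx ord0 j : 'rV[K]_n.+1) ord0])).

Definition qform_rank (q : {mpoly K[n.+1]}) : nat := \rank (qform_mx q).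

End Quadrics.

(* Main.v *)
(* Write b for the polar form of q.  For an isotropic vector p that is not in
   the radical, choose coordinates with p = e_0 and q = 2 x_0 x_1 + g(x_1, ..., x_n),
   so that b(p, .) = x_1.  On the principal open set U_p = Y \ {x_1 = 0} the
   coordinate x_0 can be traded for the function q / b(p, .)^2, which identifies
   U_p with A^(n-1) x (A^1 \ {0}) and whose fibres are those of the cylinder.
   Let y and z be points of Y whose representatives satisfy q(y) = q(z) and span
   a nondegenerate plane; as the rank is at least three, some v orthogonal to
   this plane has q(v) <> 0.  Then a suitable p = y + z + r v is isotropic with
   b(p, y) = b(p, z) <> 0, so y and z lie in the same fibre of U_p.  Any two
   points of Y are joined by two such steps through a generic third point. *)

Require Import Defs.
From mathcomp Require Import all_boot all_order all_algebra.
From mathcomp Require Import boolp classical_sets.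
From mathcomp Require Import mpoly.
From mathcomp Require Import ring.

Set Implicit Arguments.
Unset Strict Implicit.
Unset Printing Implicit Defensive.

Import GRing.Theory.
Local Open Scope ring_scope.
Local Open Scope classical_set_scope.

(** * Symmetric bilinear forms and anisotropic vectors *)

Definition bil (K : fieldType) (n : nat) (B : 'M[K]_n) (x y : 'rV[K]_n) : K :=
  (x *m B *m y^T) ord0 ord0.

Section Bilinear.
Variables (K : fieldType) (n : nat) (B : 'M[K]_n).
Hypothesis B_sym : B^T = B.
Implicit Types x y z : 'rV[K]_n.
Local Notation b := (bil B).

Lemma bilDl x y z : b (x + y) z = b x z + b y z.
Proof. by rewrite /bil !mulmxDl mxE. Qed.

Lemma bilZl (a : K) x y : b (a *: x) y = a * b x y.
Proof. by rewrite /bil -!scalemxAl mxE. Qed.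

Lemma bilC x y : b x y = b y x.
Proof.
rewrite /bil; have -> : x *m B *m y^T = (y *m B *m x^T)^T; last by rewrite mxE.
by rewrite !trmx_mul trmxK B_sym mulmxA.
Qed.

Lemma bilDr x y z : b x (y + z) = b x y + b x z.
Proof. by rewrite bilC bilDl ![b _ x]bilC. Qed.

Lemma bilZr (a : K) x y : b x (a *: y) = a * b x y.
Proof. by rewrite bilC bilZl bilC. Qed.

Definition bilE := (bilDl, bilDr, bilZl, bilZr).

(** Polarization: if every [b x x] vanished, expanding [b (x + y) (x + y)] would give
    [2 * b x y = 0] and hence [B = 0]. *)
Lemma sym_anisotropic : (2 : K) != 0 -> B != 0 -> exists x, b x x != 0.
Proof.
move=> two0 /eqP B0; apply: contrapT => isotropic; apply: B0.
have q0 x : b x x = 0 by apply/eqP/negPn/negP => nz; apply: isotropic; exists x.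
have b0 x y : b x y = 0.
  have := q0 (x + y); rewrite !bilE !q0 (bilC y x) add0r addr0 -mulr2n -mulr_natl.
  by move/eqP; rewrite mulf_eq0 (negbTE two0) => /eqP.
apply/matrixP => i j; rewrite mxE -[RHS](b0 (delta_mx ord0 i) (delta_mx ord0 j)).
by rewrite /bil -rowE trmx_delta -colE !mxE.
Qed.

End Bilinear.

(* If the form vanished on the orthogonal complement of the rows of [A], it
   would be the pull-back of a form along the coefficients of the orthogonal
   projection onto these [k] rows, hence of rank at most [k]. *)
Lemma anisotropic_orthogonal (K : fieldType) (n k : nat) (B : 'M[K]_n)
    (A : 'M[K]_(k, n)) :
  (2 : K) != 0 -> B^T = B -> A *m B *m A^T \in unitmx -> (k < \rank B)%N ->
  exists v : 'rV[K]_n, v *m B *m A^T = 0 /\ bil B v v != 0.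
Proof.
move=> two0 symB unitG ltkr; set G := A *m B *m A^T in unitG.
(* Acting on row vectors from the right, [P] is the projection onto the orthogonal complement of the
   rows of [A], along their span. *)
pose P : 'M_n := 1%:M - B *m A^T *m invmx G *m A.
have PBA : P *m B *m A^T = 0.
  rewrite !mulmxBl !mul1mx -!mulmxA (mulmxA A B) -/G mulVmx // mulmx1.
  exact: subrr.
have symPBP : (P *m B *m P^T)^T = P *m B *m P^T.
  by rewrite !trmx_mul trmxK symB mulmxA.
have [|x nz] := sym_anisotropic symPBP two0; last first.
  exists (x *m P); split; first by rewrite -!mulmxA (mulmxA P) PBA mulmx0.
  by move: nz; rewrite /bil trmx_mul !mulmxA.
apply: contraTneq ltkr => PBP0; rewrite -leqNgt.
have PB0 : P *m B = 0.
  move: PBP0; rewrite {2}/P linearB /= mulmxBr trmx1 mulmx1 !trmx_mul trmxK.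
  by rewrite !mulmxA; rewrite -!mulmxA (mulmxA B) (mulmxA P) (mulmxA P) PBA !mul0mx subr0.
have -> : B = B *m A^T *m invmx G *m A *m B.
  by apply/eqP; rewrite -subr_eq0 -{1}[B]mul1mx -mulmxBl; apply/eqP.
rewrite -!mulmxA.
apply: leq_trans (mxrankM_maxr _ _) _; apply: leq_trans (mxrankM_maxl _ _) _.
exact: rank_leq_col.
Qed.

(** * Homogeneous quadratic polynomials and their polar matrices *)

Lemma mnm_deg2 (n : nat) (m : 'X_{1.. n}) :
  mdeg m = 2 -> exists i j, m = (U_(i) + U_(j))%MM.
Proof.
move=> m2; have [i mi] : exists i, m i != 0%N.
  apply/existsP; apply: contraPT m2 => /existsPn m0.
  by rewrite mdegE big1 // => i _; apply/eqP/negPn/m0.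
have Um : (U_(i) <= m)%MM by rewrite lep1mP.
have : mdeg (m - U_(i))%MM == 1%N by move: m2; rewrite -{1}(submK Um) mdegD mdeg1 addn1 => -[->].
rewrite mdeg_eq1 => /existsP[j /eqP mj].
by exists i, j; rewrite -mj addmC submK.
Qed.

Section QuadraticForm.
Variables (K : fieldType) (n : nat).
Implicit Types (x y : 'rV[K]_n.+1) (q : {mpoly K[n.+1]}).

Lemma qform_mx_sym q : (qform_mx q)^T = qform_mx q.
Proof.
apply/matrixP => i j; rewrite !mxE addrAC.
by rewrite [delta_mx _ j + delta_mx _ i]addrC.
Qed.

(** Both sides are linear in [q], which reduces the claim to a product of two variables, possibly
    equal; its polar matrix is a half-sum of two products of Kronecker deltas. *)
Lemma qform_bil q x :
  (2 : K) != 0 -> q \is 2.-homog -> q.@[x ord0] = bil (qform_mx q) x x.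
Proof.
move=> two0 /dhomogP q2.
have ev v : q.@[v] = \sum_(m <- msupp q) q@_m * ('X_[m]).@[v].
  by rewrite {1}[q]mpolyE (raddf_sum (meval v)); apply: eq_bigr => m _; rewrite /= mevalZ.
have mevalU k l y : ('X_[U_(k) + U_(l)] : {mpoly K[n.+1]}).@[y ord0] = y ord0 k * y ord0 l.
  by rewrite mpolyXD rmorphM /= !mevalXU.
have bil_sum (B : 'M[K]_n.+1) : bil B x x = \sum_i \sum_j B i j * (x ord0 i * x ord0 j).
  rewrite /bil mxE exchange_big /=; apply: eq_bigr => j _; rewrite !mxE mulr_suml.
  by apply: eq_bigr => i _; rewrite mulrCA !mulrA.
rewrite bil_sum ev.
have -> : qform_mx q = \sum_(m <- msupp q) q@_m *: qform_mx 'X_[m].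
  apply/matrixP => i j; rewrite summxE !mxE !ev -!sumrB mulr_sumr.
  by apply: eq_bigr => m _; rewrite !mxE; ring.
under [RHS]eq_bigr => i _ do under eq_bigr => j _ do rewrite summxE mulr_suml.
under [RHS]eq_bigr => i _ do rewrite exchange_big /=.
rewrite exchange_big big_seq [RHS]big_seq; apply: eq_bigr => m /q2 /mnm_deg2[k [l ->]] /=.
under [RHS]eq_bigr => i _.
  under eq_bigr => j _ do rewrite mxE -mulrA.
  rewrite -mulr_sumr; over.
rewrite -mulr_sumr; congr (_ * _); rewrite mevalU.
have E i j : qform_mx ('X_[U_(k) + U_(l)] : {mpoly K[n.+1]}) i j =
  2^-1 * ((i == k)%:R * (j == l)%:R + (i == l)%:R * (j == k)%:R).
  rewrite !mxE !mevalU !mxE !eqxx /= ![k == _]eq_sym ![l == _]eq_sym.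
  by congr (_ * _); ring.
pose d (a i : 'I_n.+1) : K := (i == a)%:R.
have sumd (f : 'I_n.+1 -> K) a : \sum_i d a i * f i = f a.
  rewrite (bigD1 a) //= /d eqxx mul1r big1 ?addr0 // => i /negbTE->.
  by rewrite mul0r.
under [RHS]eq_bigr => i _.
  under eq_bigr => j _.
    rewrite E.
    have -> : 2^-1 * ((i == k)%:R * (j == l)%:R + (i == l)%:R * (j == k)%:R) *
        (x ord0 i * x ord0 j) =
      d l j * (2^-1 * d k i * x ord0 i * x ord0 j) +
      d k j * (2^-1 * d l i * x ord0 i * x ord0 j).
      by rewrite /d; ring.
    over.
  rewrite big_split !sumd /=.
  have -> : 2^-1 * d k i * x ord0 i * x ord0 l + 2^-1 * d l i * x ord0 i * x ord0 k =
    d k i * (2^-1 * x ord0 i * x ord0 l) + d l i * (2^-1 * x ord0 i * x ord0 k) by ring.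
  over.
by rewrite big_split !sumd /=; field.
Qed.

End QuadraticForm.

(** * Coordinates adapted to an isotropic vector *)

(** The rows [p], [e], [R] form a basis and [a], [l], [C] are the dual coordinates. It is applied to
    [l] representing [b p], where [p *m l = 0] says that [p] is isotropic. *)
Lemma adapted_basis (K : fieldType) (k : nat) (p : 'rV[K]_(2 + k)) (l : 'cV[K]_(2 + k)) :
  p != 0 -> l != 0 -> p *m l = 0 ->
  exists (e : 'rV[K]_(2 + k)) (R : 'M[K]_(k, 2 + k)) (a : 'cV[K]_(2 + k)) (C : 'M[K]_(2 + k, k)),
    [/\ forall x : 'rV_(2 + k), x = (x *m a) *m p + (x *m l) *m e + x *m C *m R,
        e *m l = 1%:M, R *m l = 0,
        e *m C = 0 /\ p *m C = 0 & R *m C = 1%:M].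
Proof.
move=> p0 l0 pl0.
have unit1 (c : K) : c != 0 -> exists d : K, d * c = 1.
  by move=> c0; exists c^-1; rewrite mulVf.
have [e el1] : exists e : 'rV_(2 + k), e *m l = 1%:M.
  have /cV0Pn[i /unit1[c c1]] := l0; exists (c *: delta_mx ord0 i).
  by rewrite -scalemxAl -rowE [row i l]mx11_scalar mxE scale_scalar_mx c1.
have [b pb1] : exists b : 'cV_(2 + k), p *m b = 1%:M.
  have /rV0Pn[i /unit1[c c1]] := p0; exists (c *: delta_mx i ord0).
  by rewrite -scalemxAr -colE [col i p]mx11_scalar mxE scale_scalar_mx c1.
pose A : 'M_(1 + 1, 2 + k) := col_mx p e.
(* The product of [A] with [row_mx b l] is lower unitriangular. *)
have rankA : \rank A = 2.
  apply/eqP; rewrite eqn_leq rank_leq_row; apply: leq_trans (mxrankM_maxl A (row_mx b l)).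
  rewrite mul_col_row pb1 pl0 el1.
  rewrite [X in (X <= _)%N](_ : _ = \rank (1%:M : 'M[K]_(1 + 1))) ?mxrank1 //.
  by rewrite mxrank_unit // unitmxE det_lblock !det1 mulr1 unitr1.
(* [U] extracts the first two rows; [complete_unitmx] then yields an invertible [E] that begins with
   [p] and [e]. *)
pose U : 'M[K]_(1 + 1, 1 + 1 + k) := row_mx 1%:M 0.
have UX m (X : 'M_(1 + 1, m)) Y : U *m col_mx X Y = X.
  by rewrite mul_row_col mul1mx mul0mx addr0.
have rankU : \rank U = 2.
  apply/eqP; rewrite eqn_leq rank_leq_row -[X in (X <= _)%N](mxrank1 K (1 + 1)).
  by rewrite -(UX _ 1%:M 0) mxrankM_maxl.
have [|E unitE UE] := @complete_unitmx _ _ _ U (col_mx A 0).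
  by rewrite UX rankA rankU.
pose R0 : 'M_(k, 2 + k) := dsubmx E.
have E_col : E = col_mx A R0.
  have -> : A = usubmx E by rewrite -[LHS](UX _ _ 0) UE -[E in LHS]vsubmxK UX.
  by rewrite vsubmxK.
(* Subtracting multiples of [e] moves the remaining rows into the kernel of [l] by a unitriangular
   change of basis. *)
pose R := R0 - R0 *m l *m e.
pose M : 'M_(1 + 1 + k) := col_mx A R.
have unitM : M \in unitmx.
  have -> : M = block_mx 1%:M 0 (row_mx 0 (- (R0 *m l))) 1%:M *m E.
    rewrite E_col mul_block_col !mul1mx mul0mx addr0 mul_row_col mul0mx add0r.
    by rewrite mulNmx addrC.
  by rewrite unitmx_mul unitE andbT unitmxE det_lblock !det1 mulr1 unitr1.
pose N := invmx M; pose C : 'M_(2 + k, k) := rsubmx N.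
pose a : 'cV_(2 + k) := lsubmx (lsubmx N : 'M_(_, 1 + 1)).
pose l' : 'cV_(2 + k) := rsubmx (lsubmx N : 'M_(_, 1 + 1)).
have NE : N = row_mx (row_mx a l') C by rewrite !hsubmxK.
have NM : row_mx (row_mx a l') C *m col_mx (col_mx p e) R = 1%:M by rewrite -NE mulVmx.
have MN : col_mx (col_mx p e) R *m row_mx (row_mx a l') C = 1%:M by rewrite -NE mulmxV.
move: MN; rewrite mul_col_row mul_col_mx (@scalar_mx_block _ (1 + 1) k).
case/eq_block_mx => _ pe_C _ RC; move: pe_C.
rewrite mul_col_mx -[X in _ = X -> _]vsubmxK => /eq_col_mx[pC eC].
have Rl : R *m l = 0 by rewrite mulmxBl -!mulmxA el1 mulmx1 subrr.
(* Both columns take the values 0 on [p], 1 on [e] and 0 on [R]. *)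
have ll' : l = l'.
  rewrite -[l]mul1mx -NM -mulmxA mul_col_mx Rl mul_row_col mulmx0 addr0.
  by rewrite mul_col_mx pl0 el1 mul_row_col mulmx0 add0r mulmx1.
exists e, R, a, C; split=> //; last by rewrite pC eC !linear0.
move=> x; rewrite -[x in LHS]mulmx1 -NM !mul_row_col -ll' !mulmxDr.
by rewrite !mulmxA.
Qed.

Lemma closed_sqrt (K : closedFieldType) (c : K) : exists r, r ^+ 2 = c.
Proof.
have [r Hr] := @solve_monicpoly K 2 (fun i => if i is 0%N then c else 0) isT.
by exists r; rewrite Hr !big_ord_recl big_ord0 /= mulr1 mul0r !addr0.
Qed.

(** * Isotropic vectors over an algebraically closed field *)

Section Isotropic.
Variables (K : closedFieldType) (n : nat) (B : 'M[K]_n).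
Hypothesis two0 : (2 : K) != 0.
Hypothesis B_sym : B^T = B.
Implicit Types p v y z : 'rV[K]_n.
Local Notation b := (bil B).

Lemma bil_eq0 (x y : 'rV[K]_n) : (x *m B *m y^T == 0) = (b x y == 0).
Proof.
rewrite [_ *m _ *m _]mx11_scalar -/(b x y).
by apply/eqP/eqP => [/matrixP/(_ ord0 ord0)|->]; rewrite ?mxE ?eqxx // raddf0.
Qed.

Lemma anisotropic_orthogonal1 y :
  (1 < \rank B)%N -> b y y != 0 -> exists v, b v y = 0 /\ b v v != 0.
Proof.
move=> rkB yy; have [||v [vy vv]] := @anisotropic_orthogonal K n 1 B y two0 B_sym.
- by rewrite [_ *m _ *m _]mx11_scalar unitmxE det_scalar1 unitfE.
- by [].
- by exists v; split=> //; apply/eqP; rewrite -bil_eq0 vy.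
Qed.

Lemma anisotropic_orthogonal2 y z :
  (2 < \rank B)%N -> b y y * b z z - b y z ^+ 2 != 0 ->
  exists v, [/\ b v y = 0, b v z = 0 & b v v != 0].
Proof.
move=> rkB D0; have bE x x' : x *m B *m x'^T = (b x x')%:M by rewrite [LHS]mx11_scalar.
have [||v [vyz vv]] := @anisotropic_orthogonal K n (1 + 1) B (col_mx y z) two0 B_sym.
- rewrite tr_col_mx mul_col_mx mul_col_row !bE (bilC B_sym z y).
  (* The adjugate of the Gram matrix of [y] and [z]; dividing it by the Gram determinant gives the
     inverse. *)
  pose adjG : 'M[K]_(1 + 1) :=
    block_mx (b z z)%:M (- b y z)%:M (- b y z)%:M (b y y)%:M.
  apply: (proj1 (@mulmx1_unit _ _ _ ((b y y * b z z - b y z ^+ 2)^-1 *: adjG) _)).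
  rewrite -scalemxAr mulmx_block -!scalar_mxM -!raddfD /=.
  have -> : b y y * - b y z + b y z * b y y = 0 by ring.
  have -> : b y z * b z z + b z z * - b y z = 0 by ring.
  have -> : b y z * - b y z + b z z * b y y = b y y * b z z - b y z ^+ 2 by ring.
  have -> : b y y * b z z + b y z * - b y z = b y y * b z z - b y z ^+ 2 by ring.
  by rewrite raddf0 -scalar_mx_block scale_scalar_mx mulVf.
- by [].
- exists v; split=> //; apply/eqP; rewrite -bil_eq0.
  + by move: vyz; rewrite tr_col_mx mul_mx_row -[0]hsubmxK => /eq_row_mx[-> _]; rewrite linear0.
  + by move: vyz; rewrite tr_col_mx mul_mx_row -[0]hsubmxK => /eq_row_mx[_ ->]; rewrite linear0.
Qed.

(** Correct [y] by a multiple of an anisotropic [v] orthogonal to it; the pairing with [y] remains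
    [b y y]. This puts every point of the complement in some cylinder. *)
Lemma isotropic_nonorthogonal y :
  (1 < \rank B)%N -> b y y != 0 -> exists p, b p p = 0 /\ b p y != 0.
Proof.
move=> rkB yy; have [v [vy vv]] := anisotropic_orthogonal1 rkB yy.
have [r r2] := closed_sqrt (- b y y / b v v).
exists (y + r *: v); rewrite !(bilE B_sym) (bilC B_sym y v) vy mulr0 !addr0 add0r.
by split=> //; rewrite mulrA -expr2 r2 divfK ?subrr.
Qed.

(* After rescaling [z] so that [b z z = b y y], look for [p] of the form
   [y + z + r v] with [v] orthogonal to both. *)
Lemma isotropic_link y z :
  (2 < \rank B)%N -> b y y != 0 -> b z z != 0 ->
  b y y * b z z - b y z ^+ 2 != 0 ->
  exists p, [/\ b p p = 0, b p y != 0, b p z != 0 &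
    b y y / b p y ^+ 2 = b z z / b p z ^+ 2].
Proof.
move=> rkB yy zz D0; have [v [vy vz vv]] := anisotropic_orthogonal2 rkB D0.
have [c c2] := closed_sqrt (b y y / b z z).
have c0 : c != 0 by rewrite -sqrf_eq0 c2 mulf_neq0 ?invr_eq0.
have c2z : c ^+ 2 * b z z = b y y by rewrite c2 divfK.
(* The pairing of the future [p] with both [y] and [c *: z]. It is nonzero because it divides
   [c ^+ 2] times the Gram determinant. *)
set s := b y y + c * b y z.
have s0 : s != 0.
  apply: contraNneq D0 => s0.
  have : c ^+ 2 * (b y y * b z z - b y z ^+ 2) = (b y y - c * b y z) * s.
    by rewrite mulrBr mulrCA c2z /s; ring.
  by rewrite s0 mulr0 => /eqP; rewrite mulf_eq0 expf_eq0 (negbTE c0).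
(* Chosen so that [b p p = s + s + r ^+ 2 * b v v] vanishes. *)
have [r r2] := closed_sqrt (- (s *+ 2) / b v v).
pose p := y + c *: z + r *: v.
have py : b p y = s.
  by rewrite /p !(bilE B_sym) vy mulr0 addr0 (bilC B_sym z y).
have pz : c * b p z = s.
  by rewrite /p !(bilE B_sym) vz mulr0 addr0 mulrDr mulrA -expr2 c2z addrC.
have pv : b p v = r * b v v.
  by rewrite /p !(bilE B_sym) ![b _ v](bilC B_sym) vy vz mulr0 !add0r.
exists p; split.
- rewrite {2}/p !(bilDr B_sym) !(bilZr B_sym) py pz pv mulrA -expr2 r2 divfK //; ring.
- by rewrite py.
- by apply: contraNneq s0 => pz0; rewrite -pz pz0 mulr0.
- by rewrite py -pz -c2z exprMn -mulf_div divff ?mul1r // sqrf_eq0.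
Qed.

(* The values of [t] to avoid are the roots of three polynomials; the last one
   is nonzero since its coefficients [b z z * b v v - b z v ^+ 2],
   [b y z * b z v] and [b y y * b z z - b y z ^+ 2] cannot all vanish. *)
Lemma nondegenerate_intermediate y z :
  (1 < \rank B)%N -> b y y != 0 -> b z z != 0 ->
  exists w, [/\ b w w != 0, b y y * b w w - b y w ^+ 2 != 0 &
                b w w * b z z - b w z ^+ 2 != 0].
Proof.
move=> rkB yy zz; have [v [vy vv]] := anisotropic_orthogonal1 rkB yy.
(* For [w = y + t *: v], [P] gives [b w w] and [Q] the Gram determinant of [w] and [z]. That of [y]
   and [w] is [b y y * b v v * t ^+ 2], so there it suffices that [t != 0]. *)
pose P : {poly K} := (b y y)%:P + b v v *: 'X^2.
pose Q : {poly K} := b z z *: P - ((b y z)%:P + b v z *: 'X) ^+ 2.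
have PE t : P.[t] = b y y + b v v * t ^+ 2 by rewrite /P !hornerE /=; ring.
have QE t : Q.[t] = b z z * (b y y + b v v * t ^+ 2) - (b y z + b v z * t) ^+ 2.
  by rewrite /Q !hornerE /=; ring.
have Q0 : Q != 0.
  apply/eqP => Q0.
  (* The values of [Q] at 0, 1 and -1 isolate its coefficients. *)
  have yz2 : b y z ^+ 2 = b z z * b y y.
    have : Q.[0] = b z z * b y y - b y z ^+ 2 by rewrite QE; ring.
    by rewrite Q0 horner0 => /esym/eqP; rewrite subr_eq0 => /eqP->.
  have yz0 : b y z != 0 by rewrite -sqrf_eq0 yz2 mulf_neq0.
  have vz0 : b v z = 0.
    have /eqP : 2 * 2 * b y z * b v z = 0.
      have <- : Q.[-1] - Q.[1] = 2 * 2 * b y z * b v z by rewrite !QE; ring.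
      by rewrite Q0 !horner0 subrr.
    by rewrite !mulf_eq0 (negbTE two0) (negbTE yz0) => /eqP.
  have := QE 1; rewrite Q0 horner0 vz0 mul0r addr0 yz2 => /esym/eqP; apply/negP.
  have -> : b z z * (b y y + b v v * 1 ^+ 2) - b z z * b y y = b z z * b v v by ring.
  exact: mulf_neq0.
have P0 : P != 0.
  apply: contraNneq yy => P0; have : P.[0] = b y y by rewrite PE expr0n mulr0 addr0.
  by rewrite P0 horner0 => <-.
have [t] := closed_nonrootP _ (mulf_neq0 (mulf_neq0 P0 Q0) (negbT (polyX_eq0 K))).
rewrite !rootM !negb_or rootX -andbA => /and3P[].
rewrite /root QE PE => Pt Qt t0.
pose w := y + t *: v.
have ww : b w w = b y y + b v v * t ^+ 2.
  by rewrite /w !(bilE B_sym) (bilC B_sym y v) vy; ring.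
exists w; rewrite ww; split=> //.
- rewrite /w !(bilE B_sym) (bilC B_sym y v) vy mulr0 addr0 mulrDr -expr2 addrC addKr.
  by rewrite !mulf_neq0 // expf_neq0.
- by rewrite mulrC /w !(bilE B_sym) [t * _]mulrC.
Qed.

End Isotropic.

(** * Classes of functions stable under polynomial operations *)

Section PolynomialClosure.
Variables (K : fieldType) (T : Type) (D : (T -> K) -> Prop).
Hypothesis D_cst : forall c, D (fun=> c).
Hypothesis D_add : forall f g, D f -> D g -> D (fun x => f x + g x).
Hypothesis D_mul : forall f g, D f -> D g -> D (fun x => f x * g x).

Lemma closed_sum (I : Type) (r : seq I) (F : I -> T -> K) :
  (forall i, D (F i)) -> D (fun x => \sum_(i <- r) F i x).
Proof.
move=> DF; elim: r => [|i r IHr].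
  by under eq_fun do rewrite big_nil; exact: D_cst.
by under eq_fun do rewrite big_cons; exact: D_add.
Qed.

(** Shared by three classes [D]: polynomial functions, quotients of forms of equal degree, and
    functions made polynomial by a power of the variable. *)
Lemma closed_meval (m : nat) (phi : T -> 'I_m -> K) (p : {mpoly K[m]}) :
  (forall j, D (phi^~ j)) -> D (fun x => p.@[phi x]).
Proof.
move=> Dphi; under eq_fun do rewrite mevalE.
apply: closed_sum => mon; apply: D_mul => //.
elim: (index_enum _) => [|i r IHr].
  by under eq_fun do rewrite big_nil; exact: D_cst.
under eq_fun do rewrite big_cons; apply: D_mul => //.
elim: (mon i) => [|e IHe].
  by under eq_fun do rewrite expr0; exact: D_cst.
by under eq_fun do rewrite exprS; exact: D_mul.
Qed.

End PolynomialClosure.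

Section PolynomialFunctions.
Variables (K : fieldType) (m : nat).

Definition polyfun (f : 'rV[K]_m -> K) :=
  exists p : {mpoly K[m]}, f = fun v => p.@[v ord0].

Lemma polyfun_cst c : polyfun (fun=> c).
Proof. by exists c%:MP; apply/funext => v; rewrite mevalC. Qed.

Lemma polyfun_coord j : polyfun (fun v => v ord0 j).
Proof. by exists 'X_j; apply/funext => v; rewrite mevalXU. Qed.

Lemma polyfun_add f g : polyfun f -> polyfun g -> polyfun (fun x => f x + g x).
Proof. by move=> [p ->] [q ->]; exists (p + q); apply/funext => v; rewrite mevalD. Qed.

Lemma polyfun_mul f g : polyfun f -> polyfun g -> polyfun (fun x => f x * g x).
Proof. by move=> [p ->] [q ->]; exists (p * q); apply/funext => v; rewrite mevalM. Qed.

End PolynomialFunctions.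

(** * Projective points, and morphisms to and from affine sets *)

Section ProjectivePoints.
Variables (K : fieldType) (n : nat).
Implicit Types (x : proj_point K n) (u v : 'rV[K]_n.+1).

Definition hvec x : 'rV[K]_n.+1 := vpick (line x).

Lemma hvec_neq0 x : hvec x != 0.
Proof. by rewrite vpick0 -dimv_eq0 dim_line. Qed.

Lemma line_vline x v : v \in line x -> v != 0 -> line x = <[v]>%VS.
Proof.
by move=> vx v0; apply/esym/eqP; rewrite -(dimv_leqif_eq _) ?dim_line ?dim_vline ?v0.
Qed.

Lemma proj_point_eq x y : line x = line y -> x = y.
Proof.
case: x y => [l d] [l' d'] /= ll; case: _ / ll d' => d'.
by rewrite (eq_irrelevance d d').
Qed.

Fact dim_proj_pt v (v0 : v != 0) : \dim <[v]>%VS = 1%N.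
Proof. by rewrite dim_vline v0. Qed.

Definition proj_pt v (v0 : v != 0) : proj_point K n := ProjPoint (dim_proj_pt v0).

Lemma hvec_proj_pt v (v0 : v != 0) : exists2 c, c != 0 & hvec (proj_pt v0) = c *: v.
Proof.
have /vlineP[c ce] := memv_pick (line (proj_pt v0)); exists c => //.
by apply: contraNneq (hvec_neq0 (proj_pt v0)) => c0; rewrite /hvec ce c0 scale0r.
Qed.

Lemma meval_homogZ d (p : {mpoly K[n.+1]}) (c : K) v :
  p \is d.-homog -> p.@[(c *: v) ord0] = c ^+ d * p.@[v ord0].
Proof.
move=> /dhomogP pd; rewrite !mevalE mulr_sumr big_seq [RHS]big_seq.
apply: eq_bigr => m /pd mf; rewrite mulrCA; congr (_ * _).
rewrite -(mf : mdeg m = d) mdegE -prodrXr -big_split /=; apply: eq_bigr => i _.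
by rewrite mxE exprMn.
Qed.

Definition lform (l : 'cV[K]_n.+1) : {mpoly K[n.+1]} := \sum_i l i ord0 *: 'X_i.

Lemma lform_homog l : lform l \is 1.-homog.
Proof. by apply: rpred_sum => i _; apply: rpredZ; rewrite dhomogX; apply/eqP; exact: mdeg1. Qed.

Lemma meval_lform l v : (lform l).@[v ord0] = (v *m l) ord0 ord0.
Proof.
rewrite mxE (raddf_sum (meval (v ord0))); apply: eq_bigr => i _ /=.
by rewrite mevalZ mevalXU mulrC.
Qed.

(** A single quotient valid on all of [V], instead of local ones, lets sums and products be formed
    without gluing. *)
Definition fracfun (V : set (proj_point K n)) (f : proj_point K n -> K) :=
  exists d (a b : {mpoly K[n.+1]}), [/\ a \is d.-homog, b \is d.-homog &
    forall x, V x -> b.@[hcoord x] != 0 /\ f x = a.@[hcoord x] / b.@[hcoord x]].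

Lemma fracfun_cst V c : fracfun V (fun=> c).
Proof.
exists 0%N, (c *: 1), 1; split; [apply: rpredZ; exact: dhomog1|exact: dhomog1|move=> x _].
by rewrite mevalZ meval1 oner_eq0 divr1 mulr1.
Qed.

Lemma fracfun_add V f g :
  fracfun V f -> fracfun V g -> fracfun V (fun x => f x + g x).
Proof.
move=> [d [a [b [ha hb fE]]]] [d' [a' [b' [ha' hb' gE]]]].
exists (d + d')%N, (a * b' + a' * b), (b * b'); split; try exact: dhomogM.
  by apply: rpredD; [exact: dhomogM|rewrite addnC; exact: dhomogM].
move=> x Vx; have [b0 ->] := fE _ Vx; have [b'0 ->] := gE _ Vx.
by rewrite mevalM mulf_neq0 // mevalD !mevalM addf_div.
Qed.

Lemma fracfun_mul V f g :
  fracfun V f -> fracfun V g -> fracfun V (fun x => f x * g x).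
Proof.
move=> [d [a [b [ha hb fE]]]] [d' [a' [b' [ha' hb' gE]]]].
exists (d + d')%N, (a * a'), (b * b'); split; try exact: dhomogM.
move=> x Vx; have [b0 ->] := fE _ Vx; have [b'0 ->] := gE _ Vx.
by rewrite !mevalM mulf_neq0 // mulf_div.
Qed.

(** Any polynomial in the coordinates of [phi] is on [V] a quotient of forms, and vanishes exactly
    where its numerator does. So closed sets pull back to closed sets, and fractions to quotients of
    forms of equal degree. *)
Lemma morphism_to_affine m (V : set (proj_space K n)) (V' : set (affine_space K m))
    (phi : proj_space K n -> affine_space K m) :
  (forall x, V x -> V' (phi x)) ->
  (forall j, fracfun V (fun x => (phi x : 'rV_m) ord0 j)) ->
  morphism_on V V' phi.
Proof.
move=> phiV frac_phi.
have frac p : fracfun V (fun x => p.@[(phi x : 'rV_m) ord0]).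
  by apply: closed_meval => //; [exact: fracfun_cst|exact: fracfun_add|exact: fracfun_mul].
have closed_preim (C : set (affine_space K m)) : zclosed C ->
    exists2 C' : set (proj_space K n), zclosed C' & forall x, V x -> C' x <-> C (phi x).
  move=> [I _ <-].
  (* Taking the numerators of all representations avoids choosing one for each equation. *)
  pose numerators : set {mpoly K[n.+1]} := [set a | exists p d b, [/\ I p, a \is d.-homog,
    b \is d.-homog & forall x, V x -> b.@[hcoord x] != 0 /\
      p.@[(phi x : 'rV_m) ord0] = a.@[hcoord x] / b.@[hcoord x]]].
  exists (proj_zeros numerators).
    exists numerators; split=> // a [p [d [b [_ ad _ _]]]]; by exists d.
  move=> x Vx; split=> [zx p Ip|zx a [p [d [b [Ip ad bd pE]]]]].
    have [d [a [b [ad bd pE]]]] := frac p; have [_ ->] := pE _ Vx.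
    by rewrite zx ?mul0r //; exists p, d, b.
  have [b0 /esym/eqP] := pE _ Vx; rewrite zx // mulf_eq0 invr_eq0 (negbTE b0) orbF.
  by move/eqP.
have open_preim W : open_in V' W -> open_in V (V `&` phi @^-1` W).
  move=> [O [Oo ->]]; have [C' cC' C'E] := closed_preim _ Oo.
  exists (~` C'); split; first by rewrite /zopen setCK.
  apply/seteqP; split=> x /= [Vx].
    by move=> [_ Ox]; split=> // /(C'E _ Vx).
  by move=> nC'; split=> //; split; [exact: phiV|apply: contrapT => /(C'E _ Vx)].
split=> // W f oW reg_f x [Vx Wx].
have [O [_ [_ [Oo Ox [P [Q [-> ->]]] fE]]]] := reg_f _ Wx.
have [O' [O'o O'E]] := open_preim (V' `&` O) (ex_intro _ O (conj Oo erefl)).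
have O'P y : V y -> O' y <-> O (phi y).
  move=> Vy; split=> [O'y|Oy].
    by have : (V `&` O') y by []; rewrite -O'E => -[_ []].
  have : (V `&` phi @^-1` (V' `&` O)) y by split=> //; split=> //; exact: phiV.
  by rewrite O'E => -[].
have [d [a [b [ha hb PE]]]] := frac P; have [d' [a' [b' [ha' hb' QE]]]] := frac Q.
exists O', (fun y => (a * b').@[hcoord y]), (fun y => (b * a').@[hcoord y]); split=> //.
- by apply/(O'P _ Vx).
- by exists (d + d')%N, (a * b'), (b * a'); split=> //; exact: dhomogM.
move=> y [Vy Wy] /(O'P _ Vy) Oy; have [] := fE _ Wy Oy.
have [b0 PEy] := PE _ Vy; have [b'0 QEy] := QE _ Vy.
rewrite PEy QEy mulf_eq0 negb_or => /andP[a'0 _] fy; rewrite [(f \o phi) y]fy.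
rewrite !mevalM mulf_neq0 //; split=> //.
by rewrite !invfM invrK [RHS]mulrACA (mulrC b'.@[_]).
Qed.

(** The vector picked by [hvec] need not be polynomial in [w], but it is a nonzero multiple of
    [Psi w]. Neither the zeros of forms nor quotients of equal degree detect this factor. *)
Lemma morphism_from_affine m (V : set (affine_space K m)) (V' : set (proj_space K n))
    (Psi : 'rV[K]_m -> 'rV[K]_n.+1) (psi : affine_space K m -> proj_space K n) :
  (forall w, V w -> V' (psi w)) ->
  (forall w, exists2 c, c != 0 & hvec (psi w) = c *: Psi w) ->
  (forall j, polyfun (fun w => Psi w ord0 j)) ->
  morphism_on V V' psi.
Proof.
move=> psiV psiE polyPsi.
have poly p : polyfun (fun w => p.@[Psi w ord0]).
  by apply: closed_meval => //; [exact: polyfun_cst|exact: polyfun_add|exact: polyfun_mul].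
have eval0 d p w : p \is d.-homog -> (p.@[hcoord (psi w)] == 0) = (p.@[Psi w ord0] == 0).
  move=> hp; rewrite /hcoord -/(hvec (psi w)); have [c c0 ->] := psiE w.
  by rewrite (meval_homogZ _ _ hp) mulf_eq0 expf_eq0 (negbTE c0) andbF.
have open_preim O : zopen O -> zopen (psi @^-1` O).
  move=> [I [hI CO]].
  exists [set r | exists2 p, I p & (fun w => p.@[Psi w ord0]) = fun w => r.@[w ord0]] => //.
  rewrite preimage_setC CO; apply/seteqP; split=> v /= zv.
    move=> p Ip; have [d hp] := hI p Ip; have [r rE] := poly p.
    apply/eqP; rewrite (eval0 _ _ _ hp); apply/eqP.
    by rewrite (congr1 (@^~ v) rE) zv //; exists p.
  move=> r [p Ip rE]; have [d hp] := hI p Ip.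
  by rewrite -(congr1 (@^~ v) rE); apply/eqP; rewrite -(eval0 _ _ _ hp) zv.
split=> //.
  move=> W [O [Oo ->]]; exists (psi @^-1` O); split; first exact: open_preim.
  by apply/seteqP; split=> v /= [Vv]; [case=> _ Ov|move=> Ov; split=> //; split=> //; exact: psiV].
move=> W f oW reg_f v [Vv Wv].
have [O [_ [_ [Oo Ov [d [p [q [hp hq -> ->]]]] fE]]]] := reg_f _ Wv.
exists (psi @^-1` O), (fun w => p.@[Psi w ord0]), (fun w => q.@[Psi w ord0]); split=> //.
- exact: open_preim.
- by have [r ->] := poly p; have [s ->] := poly q; exists r, s.
move=> w [Vw Ww] Ow; have [q0 /= ->] := fE _ Ww Ow.
rewrite -(eval0 _ _ _ hq); split=> //.
rewrite /hcoord -/(hvec (psi w)); have [c c0 ->] := psiE w.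
rewrite (meval_homogZ _ _ hp) (meval_homogZ _ _ hq).
by rewrite -mulf_div divff ?mul1r // expf_neq0.
Qed.

End ProjectivePoints.

(** * The base of the cylinders *)

Section Hyperbola.
Variable K : closedFieldType.

(** A model of the punctured line that is closed in affine space, as the base of a cylinder must
    be. *)
Definition hyperbola : set (affine_space K 2) :=
  [set z : 'rV[K]_2 | z ord0 ord0 * z ord0 ord_max = 1].

Definition hyperbola_pt (s : K) : 'rV[K]_2 :=
  \row_j (if j == ord0 then s else s^-1).

Lemma hyperbola_ptP s : s != 0 -> hyperbola (hyperbola_pt s).
Proof. by move=> s0; rewrite /hyperbola /= !mxE /= mulfV. Qed.

Lemma hyperbola_pt_coord (z : 'rV[K]_2) :
  hyperbola z -> z ord0 ord0 != 0 /\ z = hyperbola_pt (z ord0 ord0).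
Proof.
rewrite /hyperbola /= => z1; have z0 : z ord0 ord0 != 0.
  by apply: contra_eq_neq z1 => ->; rewrite mul0r eq_sym oner_eq0.
split=> //; apply/rowP => j; rewrite !mxE; case: eqP => [->//|j0].
have -> : j = ord_max.
  by apply/val_inj; case: j j0 => -[|[|//]] //= i0; case; exact/val_inj.
by apply: (mulfI z0); rewrite z1 mulfV.
Qed.

(* Restrictions of polynomials to the hyperbola are Laurent polynomials in the
   first coordinate; [N] clears the denominator. *)
Lemma meval_hyperbola (p : {mpoly K[2]}) :
  exists (P : {poly K}) N, forall s, s != 0 -> p.@[hyperbola_pt s ord0] * s ^+ N = P.[s].
Proof.
pose D (f : K -> K) := exists (P : {poly K}) N, forall s, s != 0 -> f s * s ^+ N = P.[s].
have D_cst c : D (fun=> c) by exists c%:P, 0%N => s _; rewrite mulr1 hornerC.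
apply: (@closed_meval _ _ D) => // [f g [P [M fE]] [Q [N gE]]|f g [P [M fE]] [Q [N gE]]|j].
- exists (P * 'X^N + Q * 'X^M), (M + N)%N => s s0.
  by rewrite !hornerE -fE // -gE // exprD; ring.
- by exists (P * Q), (M + N)%N => s s0; rewrite hornerM -fE // -gE // exprD mulrACA.
- case: (eqVneq j ord0) => [->|/negbTE j0].
    by exists 'X, 0%N => s _; rewrite mxE /= mulr1 hornerX.
  by exists 1, 1%N => s s0; rewrite mxE j0 hornerC mulVf.
Qed.

(** For irreducibility, a closed set missing some point of the hyperbola meets it only at roots of a
    nonzero polynomial in the first coordinate. Two such sets leave a nonzero [s] uncovered. *)
Lemma hyperbola_variety : affine_variety hyperbola.
Proof.
split.
  exists [set 'X_ord0 * 'X_ord_max - 1] => //; apply/seteqP; split=> z /=.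
    by move=> /(_ _ erefl); rewrite mevalB mevalM !mevalXU meval1 => /eqP; rewrite subr_eq0 => /eqP.
  by move=> z1 p ->; rewrite mevalB mevalM !mevalXU meval1 z1 subrr.
split; first by exists (hyperbola_pt 1); apply: hyperbola_ptP; exact: oner_neq0.
move=> C D [I _ <-] [J _ <-] sub.
have witness (L : set {mpoly K[2]}) : ~ hyperbola `<=` affine_zeros L ->
    exists2 P : {poly K}, P != 0 &
      forall s, s != 0 -> affine_zeros L (hyperbola_pt s) -> root P s.
  move=> /existsNP[z /not_implyP[/hyperbola_pt_coord[z0 zE] /existsNP[p /not_implyP[Lp pz]]]].
  have [P [N PE]] := meval_hyperbola p; exists P.
    apply: contra_notN pz => /eqP P0; move: (PE _ z0); rewrite -zE P0 horner0.
    by move/eqP; rewrite mulf_eq0 expf_eq0 (negbTE z0) andbF orbF => /eqP.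
  by move=> s s0 Ls; rewrite /root -PE // Ls ?mul0r.
apply: contrapT => /not_orP[/witness[P P0 PE] /witness[Q Q0 QE]].
have [s] := closed_nonrootP _ (mulf_neq0 (mulf_neq0 P0 Q0) (negbT (polyX_eq0 K))).
rewrite !rootM !negb_or rootX -andbA => /and3P[Ps Qs s0].
by have [/(PE _ s0)|/(QE _ s0)] := sub _ (hyperbola_ptP s0); apply/negP.
Qed.

End Hyperbola.

Lemma scalar_mx11_inj (K : fieldType) : injective (@scalar_mx K 1).
Proof. by move=> a b /matrixP/(_ ord0 ord0); rewrite !mxE. Qed.

(** * The cylinder attached to an isotropic vector *)

Section QuadricCylinder.
Variables (K : closedFieldType) (k : nat) (q : {mpoly K[k.+2]}).
Hypothesis two0 : (2 : K) != 0.
Hypothesis k_gt0 : (0 < k)%N.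
Hypothesis q_quadratic : q \is 2.-homog.
Local Notation n := k.+1.
Local Notation B := (qform_mx q).
Local Notation b := (bil B).
Local Notation Y := (~` proj_zeros [set q] : set (proj_space K n)).

Let B_sym := qform_mx_sym q.

Lemma mem_quadric_complement x : Y x <-> b (hvec x) (hvec x) != 0.
Proof.
rewrite -qform_bil //; split=> [Yx|qx0 /(_ _ erefl)/eqP].
  by apply: contra_notN Yx => /eqP qx0 _ ->.
exact/negP.
Qed.

(** Of degree zero in the representative; this is the base coordinate of the cylinder. *)
Definition height (p : 'rV[K]_n.+1) (x : proj_space K n) : K :=
  b (hvec x) (hvec x) / b p (hvec x) ^+ 2.

(** For isotropic [p] outside the radical, the removed hyperplane is tangent to the quadric at
    [p]. *)
Definition tangent_complement (p : 'rV[K]_n.+1) : set (proj_space K n) :=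
  [set x | b (hvec x) (hvec x) != 0 /\ b p (hvec x) != 0].

Lemma tangent_lformE p (v : 'rV[K]_n.+1) : (lform (B *m p^T)).@[v ord0] = b p v.
Proof. by rewrite meval_lform mulmxA (bilC B_sym). Qed.

(** A representative scaled to pair to 1 with [p] is [t *: p + u], with [u] in [e] plus the span of
    [R]. Its form value, the height, is [2 * t + b u u], so [u] and the height determine [t]. *)
Lemma quadric_cylinder p : b p p = 0 -> (exists v, b p v != 0) ->
  exists U : cylinder Y, cyl_set U = tangent_complement p /\
    forall x y, height p x = height p y -> cyl_proj U x = cyl_proj U y.
Proof.
move=> pp [v0 pv0].
pose l : 'cV_(2 + k) := B *m p^T.
have lE v : v *m l = (b p v)%:M by rewrite [LHS]mx11_scalar mulmxA (bilC B_sym).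
have p0 : p != 0.
  by apply: contraNneq pv0 => ->; rewrite -(scale0r 0) (bilZl B) mul0r.
have l0 : l != 0.
  by apply: contraNneq pv0 => l0; have := lE v0;
    rewrite l0 mulmx0 -(raddf0 (@scalar_mx K 1)) => /scalar_mx11_inj <-.
have pl0 : p *m l = 0 by rewrite lE pp raddf0.
have [e [R [a [C [decomp el Rl [eC pC] RC]]]]] := adapted_basis p0 l0 pl0.
have pe : b p e = 1 by move: el; rewrite lE => /scalar_mx11_inj.
have pR w : b p (w *m R) = 0.
  by have := lE (w *m R); rewrite -mulmxA Rl mulmx0 -(raddf0 (@scalar_mx K 1)) => /scalar_mx11_inj.
pose phi (x : proj_space K n) : affine_space K (k + 2) :=
  row_mx ((b p (hvec x))^-1 *: (hvec x *m C)) (hyperbola_pt (height p x)).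
(* The coefficient of [p] solves this equation for [t], the height being the first hyperbola
   coordinate. *)
pose Psi (v : 'rV[K]_(k + 2)) : 'rV[K]_n.+1 :=
  (2^-1 * (v ord0 (rshift k ord0) - q.@[(lsubmx v *m R + e) ord0])) *: p + (lsubmx v *m R + e).
have p_Psi v : b p (Psi v) = 1.
  by rewrite /Psi (bilDr B_sym) (bilZr B_sym) pp mulr0 add0r (bilDr B_sym) pR pe add0r.
have bil_shift c w : b p w = 1 -> b (c *: p + w) (c *: p + w) = 2 * c + b w w.
  by move=> pw; rewrite !(bilE B_sym) pp (bilC B_sym w p) pw; ring.
have q_Psi v : b (Psi v) (Psi v) = v ord0 (rshift k ord0).
  rewrite /Psi bil_shift; last by rewrite (bilDr B_sym) pR pe add0r.
  by rewrite -qform_bil //; field.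
have Psi0 v : Psi v != 0.
  apply: contraTneq (oner_neq0 K) => Psi0; rewrite negbK -(p_Psi v) Psi0.
  by rewrite -(scale0r 0) (bilZr B_sym) mul0r.
(* Since [b p (Psi v) = 1] for every [v], this makes sense off the hyperbola too. *)
pose psi (v : affine_space K (k + 2)) : proj_space K n := proj_pt (Psi0 v).
have Psi_phi x : tangent_complement p x -> Psi (phi x) = (b p (hvec x))^-1 *: hvec x.
  rewrite /tangent_complement /= => -[qx px].
  set h := hvec x in qx px *; set c := b p h in px *.
  set u := lsubmx (phi x : 'rV_(k + 2)) *m R + e.
  have hE : c^-1 *: h = (c^-1 * (h *m a) ord0 ord0) *: p + u.
    rewrite /u row_mxKl -/h -/c {1}(decomp h) lE -/c {1}[h *m a]mx11_scalar !mul_scalar_mx.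
    by rewrite !scalerDr !scalerA mulVf // scale1r -!scalemxAl addrAC addrA.
  have pu : b p u = 1 by rewrite /u (bilDr B_sym) pR pe add0r.
  have heightE : height p x = 2 * (c^-1 * (h *m a) ord0 ord0) + b u u.
    have -> : height p x = b (c^-1 *: h) (c^-1 *: h).
      by rewrite bilZl (bilZr B_sym) mulrA -invfM -expr2 mulrC.
    by rewrite hE bil_shift.
  rewrite /Psi -/u -/c -/h hE; congr (_ *: p + u).
  rewrite qform_bil // row_mxEr mxE /= heightE; field.
  by rewrite px two0.
have sub_Y : tangent_complement p `<=` Y by move=> x [/mem_quadric_complement].
have open_U : open_in Y (tangent_complement p).
  exists (~` proj_zeros [set lform (B *m p^T)]); split.
    rewrite /zopen setCK; exists [set lform (B *m p^T)]; split=> // _ ->.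
    by exists 1%N; exact: lform_homog.
  apply/seteqP; split=> x /=; have lE' := tangent_lformE p (hvec x).
    move=> [/mem_quadric_complement Yx px]; split=> // /(_ _ erefl) px0.
    by move: px; rewrite -lE' [_.@[_]]px0 eqxx.
  move=> [/mem_quadric_complement qx nz]; split=> //; apply: contra_notN nz => /eqP px0 _ ->.
  by rewrite [LHS]lE'.
have phi_iso : isomorphism_on (tangent_complement p)
    (affine_space_times k (@hyperbola K)) phi.
  split; [|exists psi; split].
  - apply: morphism_to_affine => [x [qx px]|j].
      rewrite /affine_space_times /= row_mxKr; apply: hyperbola_ptP.
      by rewrite mulf_neq0 // invr_eq0 expf_neq0.
    have hl := lform_homog (B *m p^T).
    have hl2 : lform (B *m p^T) ^+ 2 \is 2.-homog := dhomogM hl hl.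
    have qE x : q.@[hcoord x] = b (hvec x) (hvec x) := qform_bil (hvec x) two0 q_quadratic.
    have lE' x : (lform (B *m p^T)).@[hcoord x] = b p (hvec x) := tangent_lformE p (hvec x).
    have l2E x : (lform (B *m p^T) ^+ 2).@[hcoord x] = b p (hvec x) ^+ 2.
      by rewrite rmorphXn /= lE'.
    case: (split_ordP j) => i ->.
      exists 1%N, (lform (col i C)), (lform (B *m p^T)); split=> //; first exact: lform_homog.
      move=> x [_ px]; rewrite lE'; split=> //.
      rewrite row_mxEl mxE mulrC; congr (_ / _).
      by apply: esym; apply: etrans (meval_lform _ (hvec x)) _; rewrite colE mulmxA -colE mxE.
    (* The two hyperbola coordinates are the height and its inverse, whose denominators vanish
       nowhere on the cylinder. *)
    case: (eqVneq i ord0) => [->|/negbTE i0].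
      exists 2, q, (lform (B *m p^T) ^+ 2); split=> // x [_ px].
      by rewrite l2E qE expf_neq0 // row_mxEr mxE.
    exists 2, (lform (B *m p^T) ^+ 2), q; split=> // x [qx _].
    by rewrite l2E qE qx row_mxEr mxE i0 invf_div.
  - apply: (@morphism_from_affine _ _ _ _ _ Psi) => [v Zv|v|j].
    + have [c c0 hE] := hvec_proj_pt (Psi0 v).
      have [s0 _] := hyperbola_pt_coord Zv; rewrite mxE in s0.
      rewrite /tangent_complement /= /psi hE bilZl !(bilZr B_sym) q_Psi p_Psi mulr1.
      by rewrite !mulf_neq0.
    + exact: hvec_proj_pt.
    + have lin (A : 'M_(k, n.+1)) i : polyfun (fun v : 'rV[K]_(k + 2) => (lsubmx v *m A) ord0 i).
        under eq_fun do rewrite mxE; apply: closed_sum => [c|f g|i'].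
        * exact: polyfun_cst.
        * exact: polyfun_add.
        * under eq_fun do rewrite mxE.
          by apply: polyfun_mul; [exact: polyfun_coord|exact: polyfun_cst].
      have u_poly i : polyfun (fun v : 'rV[K]_(k + 2) => (lsubmx v *m R + e) ord0 i).
        under eq_fun do rewrite mxE.
        by apply: polyfun_add; [exact: lin|exact: polyfun_cst].
      have q_poly : polyfun (fun v : 'rV[K]_(k + 2) => q.@[(lsubmx v *m R + e) ord0]).
        by apply: closed_meval => //; [exact: polyfun_cst|exact: polyfun_add|exact: polyfun_mul].
      under eq_fun do rewrite /Psi 2!mxE -mulN1r mulrC.
      apply: (polyfun_add _ (u_poly j)); apply: polyfun_mul; first exact: polyfun_cst.
      apply: polyfun_mul; first exact: polyfun_cst.
      apply: polyfun_add; first exact: polyfun_coord.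
      by apply: polyfun_mul; first exact: polyfun_cst.
  - move=> x /= Ux; apply/proj_point_eq/esym/line_vline => //=.
    by rewrite Psi_phi // memvZ // memv_pick.
  - move=> v Zv; have [c c0 hE] := hvec_proj_pt (Psi0 v).
    rewrite /phi -/(psi v) in hE *.
    have pE : b p (hvec (psi v)) = c by rewrite hE (bilZr B_sym) p_Psi mulr1.
    have -> : height p (psi v) = (v : 'rV_(k + 2)) ord0 (rshift k ord0).
      rewrite /height pE hE bilZl (bilZr B_sym) q_Psi; field.
      exact: c0.
    rewrite pE hE -scalemxAl scalerA mulVf // scale1r.
    have -> : Psi v *m C = lsubmx (v : 'rV_(k + 2)).
      by rewrite /Psi !mulmxDl -scalemxAl pC eC -mulmxA RC scaler0 add0r addr0 mulmx1.
    rewrite -[RHS](@hsubmxK _ 1 k 2); congr row_mx.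
    by have [_ ->] := hyperbola_pt_coord Zv; rewrite mxE.
exists (Cylinder open_U k_gt0 (@hyperbola_variety K) phi_iso); split=> //.
by move=> x y hxy; rewrite /cyl_proj /= /phi !row_mxKr hxy.
Qed.

(** Squaring [b p] matches the degree of [q], and dividing by [q] gives a function regular on all of
    [Y]. *)
Lemma tangent_complement_principal p (U : cylinder Y) :
  cyl_set U = tangent_complement p -> principal U.
Proof.
move=> UE; pose h (x : proj_space K n) := b p (hvec x) ^+ 2 / b (hvec x) (hvec x).
exists h; split; last first.
  rewrite UE; apply/seteqP; split=> x /=.
    move=> [qx px]; rewrite mulf_neq0 ?invr_eq0 ?expf_neq0 //; split=> //.
    exact/mem_quadric_complement.
  move=> [/mem_quadric_complement qx]; rewrite mulf_eq0 negb_or => /andP[].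
  by rewrite expf_eq0.
move=> x _; exists setT, (fun x => (lform (B *m p^T) ^+ 2).@[hcoord x]), (fun x => q.@[hcoord x]).
split=> //.
- rewrite /zopen setCT; exists [set 1]; split=> [_ ->|]; first by exists 0%N; exact: dhomog1.
  by apply/seteqP; split=> // y /(_ _ erefl)/eqP; rewrite meval1 oner_eq0.
- have hl := lform_homog (B *m p^T).
  by exists 2, (lform (B *m p^T) ^+ 2), q; split=> //; exact: (dhomogM hl hl).
move=> y /mem_quadric_complement qy _; rewrite /h rmorphXn /=.
have -> : q.@[hcoord y] = b (hvec y) (hvec y) := qform_bil (hvec y) two0 q_quadratic.
by have -> : (lform (B *m p^T)).@[hcoord y] = b p (hvec y) := tangent_lformE p (hvec y).
Qed.

End QuadricCylinder.

(** * Covering and transversality *)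

Theorem proposition5p6 (K : closedFieldType) (charK0 : [pchar K] =i pred0)
    (n : nat) (q : {mpoly K[n.+1]}) (q_quadratic : q \is 2.-homog)
    (q_rank : (3 <= qform_rank q)%N)
    (X : set (proj_space K n)) (X_def : X = proj_zeros [set q]) :
  exists (I : Type) (U : I -> cylinder (~` X)),
    (forall i, principal (U i)) /\ transversal_covering U.
Proof.
subst X; have two0 : (2 : K) != 0 by rewrite (proj1 (pcharf0P K) charK0).
(* The rank is at most the number of variables, so there are at least three of them and the fibre
   dimension [k] is positive. *)
case: n q q_quadratic q_rank => [|k] q q_quadratic q_rank.
  by have := leq_trans q_rank (rank_leq_row _).
have k_gt0 : (0 < k)%N by have := leq_trans q_rank (rank_leq_row _).
have B_sym := qform_mx_sym q; pose Y : set (proj_space K k.+1) := ~` proj_zeros [set q].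
pose b := bil (qform_mx q).
have rk2 : (1 < \rank (qform_mx q))%N := ltnW q_rank.
have YP (x : proj_space K k.+1) : Y x <-> b (hvec x) (hvec x) != 0.
  exact: mem_quadric_complement.
have cyl p : b p p = 0 -> (exists v, b p v != 0) -> exists i : {U : cylinder Y | principal U},
    cyl_set (sval i) = tangent_complement q p /\
    forall x y, height q p x = height q p y -> cyl_proj (sval i) x = cyl_proj (sval i) y.
  move=> pp pv; have [U [UE Uproj]] := quadric_cylinder two0 k_gt0 q_quadratic pp pv.
  by exists (exist _ U (tangent_complement_principal two0 q_quadratic UE)).
(* Enlarging a collection of cylinders preserves transversality, so all principal
   cylinders are taken. *)
exists {U : cylinder Y | principal U}, sval; split; first by case.
have cover : \bigcup_i cyl_set (sval (i : {U : cylinder Y | principal U})) = Y.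
  apply/seteqP; split=> x; first by move=> [[U _] _ /=]; have [O [_ ->]] := cyl_open U; case.
  move=> /YP qx; have [p [pp px]] := isotropic_nonorthogonal two0 B_sym rk2 qx.
  have [|i [iE _]] := cyl p pp; first by exists (hvec x).
  by exists i => //; rewrite iE.
split=> // -[S [[x Sx] [SU nSU] inv]]; apply: nSU; rewrite cover in SU *.
have SY z : S z -> b (hvec z) (hvec z) != 0 by move=> /SU/YP.
(* By invariance [S] contains the whole fibre through [y] of the cylinder of [p], and [z] lies in
   that fibre. *)
have link y z : S y -> Y z ->
    b (hvec y) (hvec y) * b (hvec z) (hvec z) - b (hvec y) (hvec z) ^+ 2 != 0 -> S z.
  move=> Sy /YP qz D0.
  have [p [pp py pz hyz]] := isotropic_link two0 B_sym q_rank (SY _ Sy) qz D0.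
  have [|i [iE iproj]] := cyl p pp; first by exists (hvec y).
  have : (S `&` cyl_set (sval i)) z; last by case.
  rewrite (inv i) iE; split=> //; exists y; first by split=> //; split=> //; exact: SY.
  exact: iproj.
move=> z Yz; have [w [ww yw wz]] :=
  nondegenerate_intermediate two0 B_sym rk2 (SY _ Sx) (proj1 (YP z) Yz).
have w0 : w != 0.
  by apply: contraNneq ww => ->; rewrite -(scale0r 0) bilZl mul0r.
have [c c0 cw] := hvec_proj_pt w0.
have Yw : Y (proj_pt w0).
  by apply/YP; rewrite cw /b !(bilZl, bilZr B_sym) !mulf_neq0.
apply: (link (proj_pt w0)) => //.
  apply: (link x) => //; rewrite cw /b !(bilZl, bilZr B_sym).
  (* Replacing [w] by the chosen representative [c *: w] only multiplies the Gram determinant by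
     [c ^+ 2]. *)
  rewrite (_ : _ - _ = c ^+ 2 * (b (hvec x) (hvec x) * b w w - b (hvec x) w ^+ 2)).
    by rewrite mulf_neq0 // expf_neq0.
  by rewrite /b; ring.
rewrite cw /b !(bilZl, bilZr B_sym).
rewrite (_ : _ - _ = c ^+ 2 * (b w w * b (hvec z) (hvec z) - b w (hvec z) ^+ 2)).
  by rewrite mulf_neq0 // expf_neq0.
by rewrite /b; ring.
Qed.
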